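(* Let $f:\mathbb{R}^n\to\mathbb{R}$ be convex and differentiable with $L$-Lipschitz continuous gradient, $L>0$, let $\rho>0$, let $F(x)=f(x)+\rho\|x\|_1$, and suppose that $F^*=\inf_{x\in\mathbb{R}^n}F(x)>-\infty$ and that $X^*=\{x\in\mathbb{R}^n:F(x)=F^*\}$ is nonempty. Let $h^*\in\mathbb{R}^n$ be the vector such that $\nabla f(x^* )=h^*$ for all $x^*\in X^*$. Let $x^0,x^1\in\mathbb{R}^n$ and, for all $k\in\mathbb{N}$, let $$y^{k+1}=x^k+\alpha_k(x^k-x^{k-1}),\qquad x^{k+1}=\operatorname{prox}_{\lambda_k\rho\|\cdot\|_1}\big(y^{k+1}-\lambda_k\nabla f(y^{k+1})\big),$$ where either 1. $\{\lambda_k\}_{k\in\mathbb{N}}$ is nondecreasing, $0<\lambda_k\le 1/L$ and $0\le\alpha_k\le\overline{\alpha}<1$ for all $k\in\mathbb{N}$ (with $\overline{\alpha}$ independent of $k$); or 2. $x^1=x^0$, and there are constants $\lambda\in(0,1/L]$ and $a>2$ such that $\lambda_k=\lambda$ and $\alpha_k=\frac{k-1}{k+a}$ for all $k\in\mathbb{N}$. Then for all but finitely many $k$, $$\operatorname{sgn}\big(y_i^{k}-\lambda_{k-1}\nabla f(y^{k})_i\big)=-\frac{h_i^*}{\rho}\quad\text{for all } i \text{ with } |h_i^*|=\rho,$$ and $$x_i^k=y_i^k=0\quad\text{for all } i \text{ with } |h_i^*|<\rho .$$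
   Context: $\mathbb{N}=\{1,2,\dots\}$. $\operatorname{prox}_g(y)=\arg\min_{x}\{\tfrac12\|x-y\|^2+g(x)\}$. Convention: for $c\in\mathbb{R}$, $\operatorname{sgn}(c)=+1$ if $c\ge0$ and $\operatorname{sgn}(c)=-1$ if $c<0$. Under the stated assumptions $\nabla f$ is constant on $X^*$, so $h^*$ is well defined, and $|h_i^*|\le\rho$ for every $i\in\{1,\dots,n\}$. *)

(* Defs.v *)
From HB Require Import structures.
From mathcomp Require Import all_boot all_order all_algebra.
From mathcomp Require Import all_classical all_reals all_analysis.

Set Implicit Arguments.
Unset Strict Implicit.
Unset Printing Implicit Defensive.

Import Order.TTheory GRing.Theory Num.Theory.
Import numFieldNormedType.Exports.

Local Open Scope classical_set_scope.
Local Open Scope ring_scope.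

(* R^n is 'rV[R]_n. Its canonical norm `|x| is the sup norm, so the Euclidean
   norm is defined separately; the topology, hence differentiability, is the
   same for both. *)
Definition norm1 (R : realType) (n : nat) (x : 'rV[R]_n) : R :=
  \sum_(i < n) `|x 0 i|.

Definition norm2 (R : realType) (n : nat) (x : 'rV[R]_n) : R :=
  Num.sqrt (\sum_(i < n) x 0 i ^+ 2).

Definition grad (R : realType) (n : nat) (f : 'rV[R]_n -> R) (x : 'rV[R]_n) :
    'rV[R]_n :=
  \row_(i < n) 'D_(delta_mx 0 i) f x.

Definition lipschitz2 (R : realType) (n : nat) (L : R)
    (G : 'rV[R]_n -> 'rV[R]_n) : Prop :=
  forall u v, norm2 (G u - G v) <= L * norm2 (u - v).

(* For g convex and continuous the minimizer exists and is unique, so that get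
   (choice of an element of a nonempty set) returns it. *)
Definition prox (R : realType) (n : nat) (g : 'rV[R]_n -> R) (y : 'rV[R]_n) :
    'rV[R]_n :=
  get [set p | forall z,
    2^-1 * norm2 (p - y) ^+ 2 + g p <= 2^-1 * norm2 (z - y) ^+ 2 + g z].

Definition objective (R : realType) (n : nat) (f : 'rV[R]_n -> R) (rho : R)
    (x : 'rV[R]_n) : R :=
  f x + rho * norm1 x.

Definition opt_value (R : realType) (n : nat) (F : 'rV[R]_n -> R) : \bar R :=
  ereal_inf (range (fun x => (F x)%:E)).

Definition opt_set (R : realType) (n : nat) (F : 'rV[R]_n -> R) :
    set 'rV[R]_n :=
  [set x | (F x)%:E = opt_value F].

(* Unlike Num.sg, this takes the value 1 at 0. *)
Definition sgn (R : realType) (c : R) : R := if 0 <= c then 1 else -1.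

(* Main.v *)
Require Import Defs.
From HB Require Import structures.
From mathcomp Require Import all_boot all_order all_algebra.
From mathcomp Require Import all_classical all_reals all_analysis.
From mathcomp Require Import ring lra.

Set Implicit Arguments.
Unset Strict Implicit.
Unset Printing Implicit Defensive.

Import Order.TTheory GRing.Theory Num.Theory.
Import numFieldNormedType.Exports.

Local Open Scope classical_set_scope.
Local Open Scope ring_scope.

(** Only x_k - y_k -> 0 and F(x_k) -> min F are needed, not convergence of the
    iterates. Let xs be a minimizer. Minimality gives that -h is a subgradient
    of rho |.|_1 at xs, so cocoercivity of grad f yields
    |grad f(x) - h|^2 <= 2 L (F(x) - F(xs)), whence grad f(y_k) -> h. Since the
    proximal step is soft thresholding, a coordinate that stays outside its
    limiting regime would move by at least a fixed positive amount from y_k to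
    x_k.

    Both limits come from a decreasing nonnegative quantity. For bounded alpha_k
    it is |x_k - xs|^2 + C max(|x_k - xs|^2 - |x_(k-1) - xs|^2, 0)
    + M (F(x_k) - F(xs) + |x_k - x_(k-1)|^2 / (2 lambda_k)), whose decrease is
    summable and controls F(x_(k+1)) - F(xs) and |x_k - x_(k-1)|^2. For
    alpha_k = (k-1)/(k+a) it is the accelerated Lyapunov function
    2 lambda t_k^2 (F(x_k) - F(xs)) + |u_k|^2 with t_k = (k+a-1)/a and
    u_k = x_(k-1) - xs + t_k (x_k - x_(k-1)). It gives
    F(x_k) - F(xs) = O(1/k^2) and bounds u_k, hence also x_k (a convex
    combination of x_(k-1) and xs + u_k) and t_k (x_k - x_(k-1)). *)

(** * Inner product and squared-norm identities *)

Definition dot (R : realType) (n : nat) (u v : 'rV[R]_n) : R :=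
  \sum_(i < n) u 0 i * v 0 i.

Definition sqnorm (R : realType) (n : nat) (u : 'rV[R]_n) : R := dot u u.

Section EuclideanSpace.
Context {R : realType} {n : nat}.
Implicit Types (u v w : 'rV[R]_n) (a : R).

Lemma dotC u v : dot u v = dot v u.
Proof. by apply: eq_bigr => i _; rewrite mulrC. Qed.

Lemma dotDl u v w : dot (u + v) w = dot u w + dot v w.
Proof.
by rewrite /dot -big_split; apply: eq_bigr => i _; rewrite mxE mulrDl.
Qed.

Lemma dotDr u v w : dot w (u + v) = dot w u + dot w v.
Proof. by rewrite !(dotC w) dotDl. Qed.

Lemma dotZl a u v : dot (a *: u) v = a * dot u v.
Proof. by rewrite /dot mulr_sumr; apply: eq_bigr => i _; rewrite mxE mulrA. Qed.

Lemma dotZr a u v : dot u (a *: v) = a * dot u v.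
Proof. by rewrite !(dotC u) dotZl. Qed.

Lemma dotNl u v : dot (- u) v = - dot u v.
Proof. by rewrite -scaleN1r dotZl mulN1r. Qed.

Lemma dotNr u v : dot u (- v) = - dot u v.
Proof. by rewrite !(dotC u) dotNl. Qed.

Definition dotE := (dotDl, dotDr, dotNl, dotNr, dotZl, dotZr).

Lemma sqnorm_ge0 u : 0 <= sqnorm u.
Proof. by apply: sumr_ge0 => i _; rewrite -expr2 sqr_ge0. Qed.

Lemma norm2_sqr u : norm2 u ^+ 2 = sqnorm u.
Proof.
rewrite /norm2 sqr_sqrtr; last by apply: sumr_ge0 => i _; exact: sqr_ge0.
by apply: eq_bigr => i _; rewrite expr2.
Qed.

Lemma sqr_coord_le u i : u 0 i ^+ 2 <= sqnorm u.
Proof.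
rewrite /sqnorm /dot (bigD1 i) //= -expr2 lerDl.
by apply: sumr_ge0 => j _; rewrite -expr2 sqr_ge0.
Qed.

Lemma sqnorm_eq0 u : sqnorm u <= 0 -> u = 0.
Proof.
move=> u0; apply/rowP => i; rewrite mxE.
have := le_trans (sqr_coord_le u i) u0.
by rewrite le_eqVlt ltNge sqr_ge0 orbF sqrf_eq0 => /eqP.
Qed.

Lemma sqnormB u v : sqnorm (u - v) = sqnorm u - 2 * dot u v + sqnorm v.
Proof. by rewrite /sqnorm !dotE (dotC v u); ring. Qed.

Lemma sqnormZ a u : sqnorm (a *: u) = a ^+ 2 * sqnorm u.
Proof. by rewrite /sqnorm !dotE; ring. Qed.

Lemma sqnormBC u v : sqnorm (u - v) = sqnorm (v - u).
Proof. by rewrite !sqnormB (dotC v u); ring. Qed.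

Lemma sqnorm_extrapolate a u w : sqnorm (u + a *: (u - w)) =
  sqnorm u + a * (sqnorm u - sqnorm w) + (a + a ^+ 2) * sqnorm (u - w).
Proof. by rewrite /sqnorm !dotE (dotC w u); ring. Qed.

(** Combines descent inequalities tested at [u] and [v] into one square. The last term does not
    depend on [w], so it cancels between [w = x k.+1] and [w = y k.+1]. *)
Lemma sqnorm_weighted a u v w :
  a * (a - 1) * sqnorm (w - u) + a * sqnorm (w - v) =
  sqnorm (u - v + a *: (w - u)) + (a - 1) * sqnorm (u - v).
Proof.
have -> : w - v = (w - u) + (u - v) by rewrite addrA subrK.
move: (w - u) (u - v) => p q.
by rewrite /sqnorm !dotE (dotC q p); ring.
Qed.

Lemma sqnormB_le u v : sqnorm (u - v) <= 2 * (sqnorm u + sqnorm v).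
Proof.
have := sqnorm_ge0 (u + v); rewrite sqnormB {1}/sqnorm !dotE.
by rewrite (dotC v u) -!/(sqnorm _); lra.
Qed.

(** A form of Cauchy-Schwarz without square roots: expand [sqnorm (u - c *: v) >= 0]. *)
Lemma dot_le_scaled_norms c u v : 0 < c ->
  sqnorm u <= c ^+ 2 * sqnorm v -> dot u v <= c * sqnorm v.
Proof.
move=> c0 uv; have := sqnorm_ge0 (u - c *: v).
rewrite sqnormB sqnormZ dotZr => uv0.
rewrite -subr_ge0 -(pmulr_rge0 _ c0); lra.
Qed.

Lemma lipschitz2_sqnorm (L : R) (G : 'rV[R]_n -> 'rV[R]_n) u v :
  0 < L -> lipschitz2 L G -> sqnorm (G u - G v) <= L ^+ 2 * sqnorm (u - v).
Proof.
move=> L0 /(_ u v) uv; rewrite -!norm2_sqr -exprMn ler_pXn2r // nnegrE.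
  exact: sqrtr_ge0.
by rewrite mulr_ge0 ?sqrtr_ge0// ltW.
Qed.

End EuclideanSpace.

(** * Convex functions with Lipschitz gradient *)

Section SmoothConvex.
Context {R : realType} {n : nat}.
Variable f : 'rV[R]_n -> R.
Hypothesis f_diff : forall u, differentiable f u.
Implicit Types u v z : 'rV[R]_n.

Lemma derive_grad u v : 'D_v f u = dot (grad f u) v.
Proof.
rewrite deriveE // {1}(row_sum_delta v) linear_sum; apply: eq_bigr => i _.
by rewrite linearZ mxE deriveE // [RHS]mulrC.
Qed.

Lemma is_derive_line u v (t : R) :
  is_derive t 1 (fun s : R => f (u + s *: v)) (dot (grad f (u + t *: v)) v).
Proof.
rewrite -derive_grad.
have E : (fun s : R => s^-1 *: (f (u + (s *: (1:R) + t) *: v) - f (u + t *: v)))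
   = fun s : R => s^-1 *: (f (s *: v + (u + t *: v)) - f (u + t *: v)).
  apply/funext => s; rewrite scalerDl [s *: (1:R)]mulr1.
  by rewrite addrCA.
split; last by rewrite /derive /= E.
rewrite /derivable /= E.
exact: diff_derivable.
Qed.

Lemma convex_ge_tangent u z : convex_function setT f ->
  f u + dot (grad f u) (z - u) <= f z.
Proof.
move=> f_cvx; rewrite -lerBrDl -derive_grad.
have /cvg_dnbhs_at_right fl : derivable f u (z - u) by exact: diff_derivable.
rewrite /derive.
(* Convexity bounds the difference quotient only for t in (0, 1], hence the passage to the
   right-hand limit. *)
have -> : lim ((fun t : R => t^-1 *: (f (t *: (z - u) + u) - f u)) @ 0^') =
          lim ((fun t : R => t^-1 *: (f (t *: (z - u) + u) - f u)) @ 0^'+).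
  by apply/esym/cvg_lim.
apply: limr_le; first by apply/cvg_ex; eexists; exact: fl.
near=> t.
have t0 : 0 < t by [].
have t1 : t <= 1 by near: t; apply: nbhs_right_le.
have := f_cvx (Itv01 (ltW t0) t1) z u; rewrite !inE => /(_ I I).
rewrite convRE /conv /= => fz.
have E : t *: (z - u) + u = t *: z + (1 - t) *: u.
  by rewrite scalerBr scalerBl scale1r -addrA (addrC _ u).
rewrite ler_pdivrMl // E; rewrite /unstable.onem in fz.
by apply: le_trans (lerB fz (lexx (f u))) _; lra.
Unshelve. all: by end_near.
Qed.

Lemma smooth_le_quadratic (L : R) u z : 0 < L -> lipschitz2 L (grad f) ->
  f z <= f u + dot (grad f u) (z - u) + L / 2 * sqnorm (z - u).
Proof.
move=> L0 Lip; set v := z - u.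
(* [g] is [f] along the segment minus the claimed bound, up to the constant [f u]. The Lipschitz
   condition makes its derivative nonpositive, and the mean value theorem compares s = 0 with s =
   1. *)
pose p s := dot (grad f u) v * s + L / 2 * sqnorm v * s ^+ 2.
pose g s := f (u + s *: v) - p s.
pose dg s := dot (grad f (u + s *: v)) v - (dot (grad f u) v + L * sqnorm v * s).
have gd (s : R) : is_derive s (1 : R) g (dg s).
  apply: is_deriveB; first exact: is_derive_line.
  rewrite /p; apply: is_derive_eq.
  by rewrite /GRing.scale /=; field.
have [|c + gc] := @MVT R g dg 0 1 ltr01 (fun s _ => gd s).
  by apply: derivable_within_continuous => s _; exact: ex_derive.
rewrite in_itv /= => /andP[c0 c1]; move: gc; rewrite subr0 mulr1.
rewrite /g /p scale1r scale0r addr0 (addrC u) subrK mulr1 expr1n mulr0 expr0n /=.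
suff : dg c <= 0 by lra.
rewrite /dg opprD addrA subr_le0 -dotNl -dotDl [L * _ * c]mulrAC.
apply: dot_le_scaled_norms; first exact: mulr_gt0.
apply: le_trans (lipschitz2_sqnorm _ _ L0 Lip) _.
by rewrite (addrC u) addrK sqnormZ exprMn mulrA.
Qed.

End SmoothConvex.

(** * The proximal map of the l1 norm *)

Definition soft_threshold (R : realType) (t w : R) : R :=
  if t < w then w - t else if w < - t then w + t else 0.

Section Prox.
Context {R : realType} {n : nat}.

(** The residual [w - soft_threshold t w] is t, -t, or lies in [-t, t] when the threshold returns 0:
    in each case a subgradient of t|.| at the thresholded value. *)
Lemma soft_threshold_subgradient (t w z : R) : 0 <= t ->
  t * `|soft_threshold t w| + (w - soft_threshold t w) * (z - soft_threshold t w)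
    <= t * `|z|.
Proof.
move=> t0; have z1 := ler_norm z; have z2 := ler_norm (- z).
rewrite normrN in z2; rewrite /soft_threshold; case: ltP => w1.
  by rewrite gtr0_norm ?subr_gt0 //; have : t * z <= t * `|z|; nra.
case: ltP => w2; first by rewrite ltr0_norm; [have : t * - z <= t * `|z|; nra | lra].
rewrite normr0 mulr0 add0r !subr0.
have [z0|z0] := leP 0 z; nra.
Qed.

Lemma soft_threshold_row_subgradient (t : R) (w z : 'rV[R]_n) : 0 <= t ->
  let s := \row_i soft_threshold t (w 0 i) in
  t * norm1 s + dot (w - s) (z - s) <= t * norm1 z.
Proof.
move=> t0 /=; rewrite /norm1 /dot !mulr_sumr -big_split; apply: ler_sum => i _.
by rewrite !mxE; exact: soft_threshold_subgradient.
Qed.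

(** The quadratic growth [sH] shows that [s] minimizes and that no other point does, so [get] must
    return it. *)
Lemma prox_l1_soft_threshold (t : R) (w : 'rV[R]_n) : 0 <= t ->
  prox (fun z => t * norm1 z) w = \row_i soft_threshold t (w 0 i).
Proof.
move=> t0; set s := \row_i _; pose H z := 2^-1 * norm2 (z - w) ^+ 2 + t * norm1 z.
have sH z : H s + 2^-1 * sqnorm (z - s) <= H z.
  have := soft_threshold_row_subgradient w z t0; rewrite /= -/s /H !norm2_sqr.
  have -> : z - w = (z - s) - (w - s) by rewrite opprB addrA subrK.
  rewrite (sqnormBC s w) (sqnormB (z - s)) (dotC (z - s)); lra.
have : [set p | forall z, H p <= H z] s.
  by move=> z /=; apply: le_trans (sH z); rewrite lerDl mulr_ge0 ?sqnorm_ge0.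
move=> /(getI (P := [set p | forall z, H p <= H z])) /(_ s) Hp.
apply/eqP; rewrite -subr_eq0; apply/eqP/sqnorm_eq0.
by have := sH (get [set p | forall z, H p <= H z]); lra.
Qed.

Lemma prox_l1_subgradient (t : R) (w z : 'rV[R]_n) : 0 <= t ->
  let p := prox (fun z => t * norm1 z) w in
  t * norm1 p + dot (w - p) (z - p) <= t * norm1 z.
Proof.
by move=> t0; rewrite prox_l1_soft_threshold //; exact: soft_threshold_row_subgradient.
Qed.

End Prox.

(** * The proximal gradient step and its fixed points *)

Section ProxGradient.
Context {R : realType} {n : nat}.
Variables (f : 'rV[R]_n -> R) (L rho : R).
Hypothesis f_convex : convex_function setT f.
Hypothesis f_diff : forall u, differentiable f u.
Hypothesis L_gt0 : 0 < L.
Hypothesis gradf_lip : lipschitz2 L (grad f).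
Hypothesis rho_gt0 : 0 < rho.
Implicit Types u y z : 'rV[R]_n.

Let F := objective f rho.

Definition prox_grad (lam : R) y : 'rV[R]_n :=
  prox (fun z => lam * rho * norm1 z) (y - lam *: grad f y).

Lemma prox_grad_subgradient (lam : R) y z : 0 < lam ->
  let p := prox_grad lam y in
  lam * rho * norm1 p + dot (y - lam *: grad f y - p) (z - p)
    <= lam * rho * norm1 z.
Proof. by move=> l0; apply: prox_l1_subgradient; rewrite mulr_ge0 ?ltW. Qed.

(** Sum of the quadratic upper bound from y to p, the tangent bound from y to z and the proximal
    subgradient inequality. As [lam * L <= 1], the quadratic term is absorbed by the
    [- sqnorm (p - y)] of the three-point identity. *)
Lemma prox_grad_descent (lam : R) y z : 0 < lam -> lam <= 1 / L ->
  2 * lam * F (prox_grad lam y) + sqnorm (prox_grad lam y - z)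
    <= 2 * lam * F z + sqnorm (y - z).
Proof.
move=> l0 l1; have := prox_grad_subgradient y z l0; set p := prox_grad lam y.
rewrite /= => sub; rewrite /F /objective.
have up := smooth_le_quadratic f_diff y p L_gt0 gradf_lip.
have lo := convex_ge_tangent f_diff y z f_convex.
have {}up : lam * f p <= lam * f y + lam * dot (grad f y) (p - y)
    + 2^-1 * sqnorm (p - y).
  have L1 : lam * L <= 1 by rewrite -ler_pdivlMr.
  have := sqnorm_ge0 (p - y); have := ler_wpM2l (ltW l0) up; nra.
have {}lo := ler_wpM2l (ltW l0) lo.
have -> : sqnorm (p - z) = sqnorm (y - z) - sqnorm (p - y)
    - 2 * dot (y - p) (p - z).
  by rewrite /sqnorm !dotE (dotC p y) (dotC z y) (dotC z p); ring.
by move: sub up lo; rewrite !dotE; lra.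
Qed.

Section Optimum.
Variable xs : 'rV[R]_n.
Hypothesis xs_opt : forall z, F xs <= F z.

(** Descent from [xs] tested at [xs] leaves no room for a displacement, since [F] cannot drop below
    [F xs]. *)
Lemma prox_grad_fixed (lam : R) : 0 < lam -> lam <= 1 / L -> prox_grad lam xs = xs.
Proof.
move=> l0 l1; apply/eqP; rewrite -subr_eq0; apply/eqP/sqnorm_eq0.
have := prox_grad_descent xs xs l0 l1.
have := ler_wpM2l (ltW l0) (xs_opt (prox_grad lam xs)).
have -> : sqnorm (xs - xs) = 0 by rewrite subrr -(scale0r xs) sqnormZ expr0n mul0r.
lra.
Qed.

(* The subgradient inequality of the proximal step, at its fixed point xs. *)
Lemma optimality_condition z :
  rho * norm1 xs <= rho * norm1 z + dot (grad f xs) (z - xs).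
Proof.
have l0 : 0 < 1 / L by rewrite divr_gt0.
have := prox_grad_subgradient xs z l0.
rewrite /= prox_grad_fixed // addrAC subrr add0r dotNl dotZl => sub.
by rewrite -(ler_pM2l l0); lra.
Qed.

Lemma sqnorm_grad_gap u : sqnorm (grad f u - grad f xs) <= 2 * L * (F u - F xs).
Proof.
(* [z] is a gradient step from [u] for [f] minus its linear part at [xs]. Bound [f z] above from [u]
   and below from [xs]; optimality then trades the linear term for a difference of l1 norms. *)
set d := grad f u - grad f xs; pose z := u - L^-1 *: d.
have up := smooth_le_quadratic f_diff u z L_gt0 gradf_lip.
have lo := convex_ge_tangent f_diff xs z f_convex.
have opt := optimality_condition u.
have zu : z - u = - (L^-1 *: d) by rewrite /z addrAC subrr add0r.
rewrite -ler_pdivrMl ?mulr_gt0 // /F /objective.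
have zx : z - xs = (u - xs) - L^-1 *: d by rewrite /z addrAC.
rewrite zu in up; rewrite zx in lo.
have dd : sqnorm d = dot (grad f u) d - dot (grad f xs) d by rewrite -dotNl -dotDl.
have e1 : sqnorm (- (L^-1 *: d)) = L^-1 ^+ 2 * sqnorm d.
  by rewrite -scaleNr sqnormZ sqrrN.
have e2 : L / 2 * (L^-1 ^+ 2 * sqnorm d) = (2 * L)^-1 * sqnorm d.
  by field; rewrite gt_eqF.
have e3 : L^-1 * sqnorm d = 2 * ((2 * L)^-1 * sqnorm d).
  by field; rewrite gt_eqF.
move: up lo opt; rewrite e1 e2 (dotDr (u - xs)) !dotNr !dotZr.
have := congr1 (fun r => L^-1 * r) dd; rewrite /= e3 mulrBr; lra.
Qed.

End Optimum.
End ProxGradient.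

(** * Limits of real sequences from summable decrease *)

Section LyapunovSequences.
Context {R : realType}.

Lemma summable_decrease_cvg0 (Q w : nat -> R) :
  (forall k, (1 <= k)%N -> 0 <= Q k) -> (forall k, (1 <= k)%N -> 0 <= w k) ->
  (forall k, (1 <= k)%N -> Q k.+1 + w k <= Q k) ->
  w k @[k --> \oo] --> 0.
Proof.
move=> Q0 w0 dec.
(* The hypotheses start at index 1, so the series summed is that of [w k.+1]; telescoping bounds its
   partial sums by [Q 1]. *)
rewrite -cvg_shiftS.
apply: cvg_series_cvg_0; apply: nondecreasing_is_cvgn.
  by apply/nondecreasing_seqP => k; rewrite /series /= big_nat_recr //= lerDl w0.
exists (Q 1%N) => _ [k _ <-]; rewrite /series /=.
suff : \sum_(0 <= j < k) w j.+1 <= Q 1%N - Q k.+1.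
  by move=> /le_trans; apply; rewrite gerBl Q0.
elim: k => [|k IH]; first by rewrite big_geq // subrr.
by rewrite big_nat_recr //=; have := dec k.+1 isT; lra.
Qed.

Lemma cvg0_squeeze (u w : nat -> R) (c : R) :
  (forall k, (1 <= k)%N -> 0 <= u k /\ u k <= c * w k) ->
  w k @[k --> \oo] --> 0 -> u k @[k --> \oo] --> 0.
Proof.
move=> uw w0; apply: (@squeeze_cvgr _ _ _ _ (cst 0) (fun k => c * w k)).
- near=> k; apply/andP; apply: uw; near: k; exact: nbhs_infty_ge.
- exact: cvg_cst.
- by rewrite -[X in _ --> X](mulr0 c); apply: cvgMr.
Unshelve. all: by end_near.
Qed.

End LyapunovSequences.

(** * Vanishing gaps and increments in both parameter regimes *)

Section InertialConvergence.
Context {R : realType} {n : nat}.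
Variables (F : 'rV[R]_n -> R) (xs : 'rV[R]_n) (x y : nat -> 'rV[R]_n).
Variables (alpha lambda : nat -> R).
Hypothesis xs_opt : forall z, F xs <= F z.
Hypothesis yE : forall k, (1 <= k)%N -> y k.+1 = x k + alpha k *: (x k - x k.-1).
Hypothesis lambda_gt0 : forall k, (1 <= k)%N -> 0 < lambda k.
Hypothesis descent : forall k z, (1 <= k)%N ->
  2 * lambda k * F (x k.+1) + sqnorm (x k.+1 - z)
    <= 2 * lambda k * F z + sqnorm (y k.+1 - z).

Let V k := F (x k) - F xs.
Let D k := sqnorm (x k - x k.-1).
Let Phi k := sqnorm (x k - xs).

Let V_ge0 k : 0 <= V k. Proof. by rewrite subr_ge0. Qed.
Let D_ge0 k : 0 <= D k. Proof. exact: sqnorm_ge0. Qed.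
Let Phi_ge0 k : 0 <= Phi k. Proof. exact: sqnorm_ge0. Qed.

Lemma energy_step k : (1 <= k)%N ->
  2 * lambda k * V k.+1 + D k.+1 <= 2 * lambda k * V k + alpha k ^+ 2 * D k.
Proof.
move=> k1; have := descent (x k) k1.
by rewrite yE // addrAC subrr add0r sqnormZ /V /D /=; lra.
Qed.

Lemma distance_step k : (1 <= k)%N ->
  2 * lambda k * V k.+1 + Phi k.+1
    <= Phi k + alpha k * (Phi k - Phi k.-1) + (alpha k + alpha k ^+ 2) * D k.
Proof.
move=> k1; have := descent xs k1; rewrite yE // addrAC.
rewrite /V /D /Phi.
have -> : x k - x k.-1 = (x k - xs) - (x k.-1 - xs) by rewrite opprB addrA subrK.
by rewrite sqnorm_extrapolate; lra.
Qed.

Lemma inertial_cvg_bounded_alpha (lmax abar : R) :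
  (forall j k, (1 <= j)%N -> (j <= k)%N -> lambda j <= lambda k) ->
  (forall k, (1 <= k)%N -> lambda k <= lmax) ->
  abar < 1 -> (forall k, (1 <= k)%N -> 0 <= alpha k /\ alpha k <= abar) ->
  V k @[k --> \oo] --> 0 /\ D k @[k --> \oo] --> 0.
Proof.
move=> lam_nd lam_le abar1 alphaP.
have abar0 : 0 <= abar by have [] := alphaP 1%N isT; exact: le_trans.
have l1 := lambda_gt0 (k := 1%N) isT.
have lmax0 : 0 < lmax by apply: lt_le_trans (lam_le 1%N isT).
have b0 : 0 < 1 - abar by rewrite subr_gt0.
(* [energy_step] divided by [2 * lambda k]; monotone step sizes allow replacing [lambda k] by
   [lambda k.+1] under [D k.+1]. *)
pose E k := V k + D k / (2 * lambda k).
(* Solves C = abar (1 + C), so that one step turns (1 + C) times the old positive part, damped by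
   abar, back into C times it. *)
pose C := abar / (1 - abar).
have C0 : 0 <= C by rewrite divr_ge0 // ltW.
pose P k := Phi k + C * Num.max (Phi k - Phi k.-1) 0.
have E_dec k : (1 <= k)%N -> E k.+1 + (1 - abar) / (2 * lmax) * D k <= E k.
  move=> k1; have := energy_step k1; rewrite /E.
  have [a0 a1] := alphaP k k1.
  have lk := lambda_gt0 k1.
  have lk1 := lam_nd k k.+1 k1 (leqnSn k).
  have lkm := lam_le k k1.
  set m := (2 * lambda k)^-1; set m' := (2 * lambda k.+1)^-1.
  have m0 : 0 < m by rewrite invr_gt0 mulr_gt0.
  have mm' : m' <= m by rewrite lef_pV2 ?posrE ?mulr_gt0 ?lambda_gt0 // ler_pM2l.
  have mmax : (2 * lmax)^-1 <= m by rewrite lef_pV2 ?posrE ?mulr_gt0 // ler_pM2l.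
  have mK : m * (2 * lambda k) = 1 by rewrite mulVf // gt_eqF // mulr_gt0.
  move/(ler_wpM2l (ltW m0)).
  rewrite !mulrDr !(mulrA m (2 * lambda k)) mK !mul1r; have := ler_wpM2r (D_ge0 k.+1) mm'.
  have := ler_wpM2r (mulr_ge0 (ltW b0) (D_ge0 k)) mmax.
  have : m * alpha k ^+ 2 * D k <= m * abar * D k.
    by rewrite ler_wpM2r // ler_pM2l //; nra.
  by rewrite /V; lra.
have P_dec k : (1 <= k)%N ->
    P k.+1 + 2 * lambda 1%N * V k.+1 <= P k + 2 / (1 - abar) * D k.
  move=> k1; have := distance_step k1; rewrite /P.
  have [a0 a1] := alphaP k k1.
  have lk := ler_wpM2r (V_ge0 k.+1) (lam_nd 1%N k isT k1).
  set d := Phi k - _; set d' := Phi k.+1 - _; set q := (1 - abar)^-1.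
  have q1 : 1 <= q by rewrite invf_ge1 // gerBl.
  have Cq : C = abar * q by [].
  have qE : q = 1 + abar * q.
    by have : (1 - abar) * q = 1 by [rewrite /q divff // gt_eqF]; lra.
  clearbody q.
  have dmax : alpha k * d <= abar * Num.max d 0.
    have := le_max d d 0; have := le_max 0 d 0; rewrite !lexx orbT /= => p0 pd.
    by apply: le_trans (ler_wpM2l a0 pd) _; exact: ler_wpM2r.
  have aD : (alpha k + alpha k ^+ 2) * D k <= 2 * D k by rewrite ler_wpM2r //; nra.
  have p0 : 0 <= Num.max d 0 by rewrite le_max lexx orbT.
  move=> step.
  have v0 : 0 <= 2 * lambda 1%N * V k.+1 by rewrite !mulr_ge0 // ltW.
  have {step} : d' + 2 * lambda 1%N * V k.+1 <= abar * Num.max d 0 + 2 * D k.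
    by rewrite /d'; lra.
  have e : Phi k.+1 = Phi k + d' by rewrite /d' addrC subrK.
  rewrite e Cq; move: {e} p0 v0 (D_ge0 k).
  move: (Num.max d 0) (2 * _ * V _) (D k) => p v D0 p0 v0 D00 step.
  have [d'0|d'0] := leP 0 d'.
    have := ler_wpM2l (le_trans ler01 q1) step.
    have : q * d' = d' + abar * q * d' by rewrite {1}qE mulrDl mul1r.
    nra.
  nra.
(* [M] times the decrease rate of [E] is [2 / (1 - abar) + 1]: this pays for the error in [P_dec]
   and leaves one [D k] over. *)
pose M := (2 / (1 - abar) + 1) / ((1 - abar) / (2 * lmax)).
have M0 : 0 <= M.
  by apply: divr_ge0; rewrite ?addr_ge0 ?divr_ge0 ?mulr_ge0 // ?(ltW b0) ?(ltW lmax0).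
have w0 : (2 * lambda 1%N * V k.+1 + D k) @[k --> \oo] --> 0.
  apply: (@summable_decrease_cvg0 _ (fun k => P k + M * E k)) => k k1.
  - have P0 : 0 <= P k by rewrite addr_ge0 // mulr_ge0 // le_max lexx orbT.
    have E0 : 0 <= E k by rewrite addr_ge0 // divr_ge0 // mulr_ge0 // ltW ?lambda_gt0.
    by rewrite addr_ge0 // mulr_ge0.
  - by rewrite addr_ge0 // !mulr_ge0 // ltW.
  - have := ler_wpM2l M0 (E_dec k k1).
    rewrite mulrDr mulrA {2}/M divfK ?gt_eqF ?divr_gt0 ?mulr_gt0 //.
    by have := P_dec k k1; lra.
split.
  rewrite -cvg_shiftS; apply: (cvg0_squeeze (c := (2 * lambda 1%N)^-1) _ w0) => k k1.
  split=> //; rewrite mulrDr mulKf ?gt_eqF ?mulr_gt0 // lerDl mulr_ge0 //.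
  by rewrite invr_ge0 mulr_ge0 // ltW.
apply: (cvg0_squeeze (c := 1) _ w0) => k k1.
by split=> //; rewrite mul1r lerDr !mulr_ge0 // ltW.
Qed.

Lemma inertial_cvg_nesterov (lam a : R) : 0 < lam -> 2 < a ->
  (forall k, (1 <= k)%N -> lambda k = lam /\ alpha k = (k%:R - 1) / (k%:R + a)) ->
  V k @[k --> \oo] --> 0 /\ D k @[k --> \oo] --> 0.
Proof.
move=> l0 a2 par.
pose t k : R := (k%:R + a - 1) / a.
pose u k := (x k.-1 - xs) + t k *: (x k - x k.-1).
pose W k := 2 * lam * t k ^+ 2 * V k + sqnorm (u k).
have a0 : 0 < a by lra.
have t_ge k : (1 <= k)%N -> k%:R / a <= t k.
  by move=> k1; rewrite ler_pM2r ?invr_gt0 //; lra.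
have t_ge1 k : (1 <= k)%N -> 1 <= t k.
  move=> k1; rewrite ler_pdivlMr // mul1r.
  by have : 1 <= k%:R :> R by [rewrite ler1n]; lra.
have tS k : t k.+1 = t k + a^-1 by rewrite /t -natr1; field; rewrite gt_eqF.
(* T (T - 1) times the descent inequality at x k plus T times the one at xs;
   T (T - 1) <= t k ^+ 2 is where 2 <= a is used. *)
have W_dec k : (1 <= k)%N -> W k.+1 <= W k.
  move=> k1; have [lk ak] := par k k1.
  have t1 := t_ge1 k.+1 isT; set T := t k.+1 in t1 *.
  have k1R : 1 <= k%:R :> R by rewrite ler1n.
  have T0 : 0 <= T by apply: le_trans t1.
  (* So [alpha k] is (t_k - 1) / t_(k+1), the choice that makes the weighted point built from
     [y k.+1] equal to [u k] below. *)
  have Ta : T * alpha k = t k - 1.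
    by rewrite ak /T /t -natr1; field; rewrite !gt_eqF //; lra.
  have := descent (x k) k1; have := descent xs k1; rewrite lk => dxs dx.
  have {}dxs := ler_wpM2l T0 dxs.
  have {}dx := ler_wpM2l (mulr_ge0 T0 (etrans (subr_ge0 1 T) t1)) dx.
  have wx := sqnorm_weighted T (x k) xs (x k.+1).
  have wy := sqnorm_weighted T (x k) xs (y k.+1).
  have uk : x k - xs + T *: (y k.+1 - x k) = u k.
    rewrite yE // /u; apply/rowP => i; rewrite !mxE.
    by have := congr1 ( *%R^~ (x k 0 i - x k.-1 0 i)) Ta; rewrite /=; lra.
  have uk1 : x k - xs + T *: (x k.+1 - x k) = u k.+1 by [].
  rewrite uk in wy; rewrite uk1 in wx.
  have TT : T * (T - 1) <= t k ^+ 2.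
    have b2 : a^-1 < 2^-1 by rewrite ltf_pV2 ?posrE.
    have b0 : 0 < a^-1 by rewrite invr_gt0.
    by have := t_ge1 k k1; rewrite /T tS; nra.
  have : lam * (T * (T - 1)) * V k <= lam * t k ^+ 2 * V k.
    by rewrite ler_wpM2r // ler_pM2l.
  by move: dx dxs wx wy; rewrite /W -/T /V; lra.
have W_le k : (1 <= k)%N -> W k <= W 1%N.
  elim: k => // -[|k] IH _ //.
  by apply: le_trans (W_dec k.+1 isT) (IH isT).
set B := W 1%N in W_le.
have uB k : (1 <= k)%N -> sqnorm (u k) <= B.
  move=> k1; apply: le_trans (W_le k k1); rewrite /W lerDr.
  by rewrite mulr_ge0 // mulr_ge0 ?sqr_ge0 // mulr_ge0 // ltW.
have VB k : (1 <= k)%N -> 2 * lam * t k ^+ 2 * V k <= B.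
  by move=> k1; apply: le_trans (W_le k k1); rewrite /W lerDl sqnorm_ge0.
have B0 : 0 <= B by apply: le_trans (uB 1%N isT); exact: sqnorm_ge0.
have uS k : t k.+1 *: (x k.+1 - x k) = u k.+1 - (x k - xs).
  by rewrite /u /= addrAC subrr add0r.
(* By [sqnorm_weighted], [Phi k.+2] is at most the mean of [Phi k.+1] and [sqnorm (u k.+2)] with
   weights 1 - 1/t and 1/t, so the bound propagates. *)
have PhiB k : Phi k.+1 <= Phi 1%N + B.
  elim: k => [|k IH]; first by rewrite lerDl.
  have t1 := t_ge1 k.+2 isT.
  have t0 : 0 < t k.+2 by apply: lt_le_trans t1.
  have := sqnorm_weighted (t k.+2) (x k.+1) xs (x k.+2).
  have -> : x k.+1 - xs + t k.+2 *: (x k.+2 - x k.+1) = u k.+2 by [].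
  have := uB k.+2 isT; have := sqnorm_ge0 (x k.+2 - x k.+1).
  rewrite -!/(Phi _) => d0 u0 w.
  rewrite -(ler_pM2l t0); have := ler_wpM2l (etrans (subr_ge0 1 _) t1) IH.
  have := mulr_ge0 (mulr_ge0 (ltW t0) (etrans (subr_ge0 1 _) t1)) d0.
  by have := Phi_ge0 1; lra.
have DB k : (1 <= k)%N -> t k.+1 ^+ 2 * D k.+1 <= 2 * (Phi 1%N + 2 * B).
  move=> k1; rewrite -sqnormZ /= uS; apply: le_trans (sqnormB_le _ _) _.
  rewrite ler_pM2l // -/(Phi k).
  by have := uB k.+1 isT; case: k k1 => // k _; have := PhiB k; lra.
(* As t_(k+1) is at least 1, its square is at least (k+1)/a, and comparison with the harmonic
   sequence suffices. *)
have bound (w : nat -> R) c : 0 <= c -> (forall k, 0 <= w k) ->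
    (forall k, (1 <= k)%N -> t k.+1 ^+ 2 * w k.+1 <= c) -> w k @[k --> \oo] --> 0.
  move=> c0 w0 wc; rewrite -cvg_shiftS.
  apply: (cvg0_squeeze (c := c * a) _ cvg_harmonic) => k k1; split=> //.
  have t1 := t_ge1 k.+1 isT.
  rewrite /harmonic /= ler_pdivlMr ?ltr0Sn // -ler_pdivrMr // -mulrA.
  apply: le_trans (wc k k1); rewrite mulrC; apply: ler_wpM2r => //.
  apply: le_trans (t_ge k.+1 isT) _.
  by rewrite expr2 ler_peMl // (le_trans ler01).
split.
  apply: (bound _ (B / (2 * lam))) => // [|k k1].
    by rewrite divr_ge0 // mulr_ge0 // ltW.
  rewrite ler_pdivlMr ?mulr_gt0 // mulrC mulrA; exact: VB.
apply: (bound _ (2 * (Phi 1%N + 2 * B))) => //.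
by rewrite mulr_ge0 // addr_ge0 // mulr_ge0.
Qed.

End InertialConvergence.

(** * Finite identification of zeros and signs, coordinate by coordinate *)

Section Identification.
Context {R : realType}.

(** In the two nonzero branches the displacement is [- lam * (g + rho)] or [lam * (rho - g)].
    Closeness of g to h keeps both factors above half the gap [rho - |h|], contradicting the small
    move. *)
Lemma soft_threshold_interior (l0 lam rho g h y : R) :
  0 < l0 -> l0 <= lam -> `|h| < rho -> `|g - h| < (rho - `|h|) / 2 ->
  `|soft_threshold (lam * rho) (y - lam * g) - y| < l0 * ((rho - `|h|) / 2) ->
  soft_threshold (lam * rho) (y - lam * g) = 0.
Proof.
move=> l00 l0l hr; have e0 : 0 < (rho - `|h|) / 2 by rewrite divr_gt0 // subr_gt0.
rewrite ltr_distl => /andP[g1 g2].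
have := ler_norm h; have := ler_norm (- h); rewrite normrN => h1 h2.
have le : l0 * ((rho - `|h|) / 2) <= lam * ((rho - `|h|) / 2) by rewrite ler_pM2r.
move=> /lt_le_trans/(_ le); rewrite /soft_threshold ltr_norml => /andP[].
have lam0 : 0 < lam by apply: lt_le_trans l0l.
case: (ltP (lam * rho)) => _.
  have : lam * ((rho - `|h|) / 2) < lam * (g + rho) by rewrite ltr_pM2l //; lra.
  by move=> H1 H2 H3; exfalso; lra.
case: (ltP _ (- (lam * rho))) => _ //.
have : lam * ((rho - `|h|) / 2) < lam * (rho - g) by rewrite ltr_pM2l //; lra.
by move=> H1 H2 H3; exfalso; lra.
Qed.

(** Take h = rho and suppose [y - lam * g >= 0]. If thresholding gives 0, the move is -y with y
    above [lam * rho / 2]; otherwise it is [- lam * (g + rho)]. Both are too long. This also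
    excludes the value 0, where [sgn] is 1. The case h = -rho is symmetric. *)
Lemma sgn_boundary (l0 lam rho g h y : R) :
  0 < l0 -> l0 <= lam -> 0 < rho -> `|h| = rho -> `|g - h| < rho / 2 ->
  `|soft_threshold (lam * rho) (y - lam * g) - y| < l0 * (rho / 2) ->
  sgn (y - lam * g) = - (h / rho).
Proof.
move=> l00 l0l r0 hr; rewrite ltr_distl => /andP[g1 g2].
have le : l0 * (rho / 2) <= lam * (rho / 2) by rewrite ler_pM2r // divr_gt0.
move=> /lt_le_trans/(_ le); rewrite ltr_norml => /andP[].
have lam0 : 0 < lam by apply: lt_le_trans l0l.
have lr0 : 0 < lam * rho by rewrite mulr_gt0.
have := ler_pM2l lam0 (h - rho / 2) g; have := ler_pM2l lam0 g (h + rho / 2).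
rewrite (ltW g1) (ltW g2) => gl gu; rewrite /sgn.
have [h0|h0] := leP 0 h.
  rewrite ger0_norm // in hr; rewrite hr divff ?gt_eqF //.
  rewrite hr in gl gu; case: ifP => // c0.
  rewrite /soft_threshold; case: (ltP (lam * rho)) => c1; first lra.
  by rewrite ifN; [lra | rewrite -leNgt; lra].
rewrite ltr0_norm // in hr; have {}hr : h = - rho by rewrite -hr opprK.
rewrite hr mulNr divff ?gt_eqF // opprK; rewrite hr in gl gu.
case: ifPn => //; rewrite -ltNge => c0.
rewrite /soft_threshold; case: (ltP (lam * rho)) => c1; first lra.
by case: (ltP _ (- (lam * rho))) => c2; lra.
Qed.

Lemma sqnorm_cvg0_coord (n : nat) (u : nat -> 'rV[R]_n) (i : 'I_n) (eps : R) :
  sqnorm (u k) @[k --> \oo] --> 0 -> 0 < eps -> \forall k \near \oo, `|u k 0 i| < eps.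
Proof.
move=> /cvgr0Pnorm_lt u0 e0.
have {u0} := u0 (eps ^+ 2) (exprn_gt0 _ e0); apply: filterS => k.
rewrite ger0_norm ?sqnorm_ge0 // => /(le_lt_trans (sqr_coord_le _ i)).
by rewrite -(real_normK (num_real _)) ltr_pXn2r // nnegrE ltW.
Qed.

Lemma opt_set_le (n : nat) (F : 'rV[R]_n -> R) xs :
  opt_set F xs -> forall z, F xs <= F z.
Proof.
by rewrite /opt_set /= => E z; rewrite -lee_fin E; apply: ereal_inf_lbound; exists z.
Qed.

End Identification.

Theorem theorem2 (R : realType) (n : nat) (f : 'rV[R]_n -> R) (L rho : R)
  (h : 'rV[R]_n) (x y : nat -> 'rV[R]_n) (alpha lambda : nat -> R)
  (f_convex : convex_function setT f)
  (f_diff : forall u, differentiable f u)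
  (L_gt0 : 0 < L)
  (gradf_lip : lipschitz2 L (grad f))
  (rho_gt0 : 0 < rho)
  (Fstar_gtNy : (-oo < opt_value (objective f rho))%E)
  (Xstar_neq0 : opt_set (objective f rho) !=set0)
  (hE : forall xs, opt_set (objective f rho) xs -> grad f xs = h)
  (yE : forall k, (1 <= k)%N ->
     y k.+1 = x k + alpha k *: (x k - x k.-1))
  (xE : forall k, (1 <= k)%N ->
     x k.+1 = prox (fun z => lambda k * rho * norm1 z)
                (y k.+1 - lambda k *: grad f (y k.+1)))
  (params :
     ((forall j k, (1 <= j)%N -> (j <= k)%N -> lambda j <= lambda k) /\
      exists abar : R, abar < 1 /\
        forall k, (1 <= k)%N ->
          0 < lambda k /\ lambda k <= 1 / L /\
          0 <= alpha k /\ alpha k <= abar)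
     \/
     (x 1%N = x 0%N /\
      exists lam a : R, 0 < lam /\ lam <= 1 / L /\ 2 < a /\
        forall k, (1 <= k)%N ->
          lambda k = lam /\ alpha k = (k%:R - 1) / (k%:R + a))) :
  \forall k \near \oo,
    (forall i : 'I_n, `|h 0 i| = rho ->
       sgn (y k 0 i - lambda k.-1 * grad f (y k) 0 i) = - (h 0 i / rho)) /\
    (forall i : 'I_n, `|h 0 i| < rho -> x k 0 i = 0 /\ y k 0 i = 0).
Proof.
have [xs xs_opt_set] := Xstar_neq0.
have xs_opt := opt_set_le xs_opt_set.
have grad_xs := hE xs xs_opt_set.
pose V k := objective f rho (x k) - objective f rho xs.
pose D k := sqnorm (x k - x k.-1).
have V_ge0 k : 0 <= V k by rewrite subr_ge0.
have D_ge0 k : 0 <= D k by exact: sqnorm_ge0.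
(* All that is kept of the two regimes; [l0] is [lambda 1] in the first and the constant step in the
   second. *)
have [l0 [l00 [lamP [alphaP [V0 D0]]]]] : exists l0, 0 < l0 /\
    (forall k, (1 <= k)%N -> l0 <= lambda k) /\
    (forall k, (1 <= k)%N -> 0 <= alpha k /\ alpha k <= 1) /\
    V k @[k --> \oo] --> 0 /\ D k @[k --> \oo] --> 0.
  have descent : (forall k, (1 <= k)%N -> 0 < lambda k /\ lambda k <= 1 / L) ->
      forall k z, (1 <= k)%N ->
      2 * lambda k * objective f rho (x k.+1) + sqnorm (x k.+1 - z)
        <= 2 * lambda k * objective f rho z + sqnorm (y k.+1 - z).
    move=> lamP k z k1; have [lam0 lamL] := lamP k k1; rewrite xE //.
    exact: (prox_grad_descent f_convex f_diff L_gt0 gradf_lip rho_gt0).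
  case: params => [[lam_nd [abar [abar1 par]]]|[_ [lam [a [lam0 [lamL [a2 par]]]]]]].
    have lamP k : (1 <= k)%N -> 0 < lambda k /\ lambda k <= 1 / L.
      by move=> /par[? []].
    have alphaP k : (1 <= k)%N -> 0 <= alpha k /\ alpha k <= abar.
      by move=> /par[? [? []]].
    exists (lambda 1%N); split; first by case: (lamP 1%N isT).
    split; first by move=> k k1; exact: lam_nd.
    split; first by move=> k /alphaP[? ?]; split=> //; lra.
    apply: (inertial_cvg_bounded_alpha xs_opt yE _ (descent lamP) lam_nd _ abar1 alphaP).
    - by move=> k /lamP[].
    - by move=> k /lamP[_]; exact.
  have lamP k : (1 <= k)%N -> 0 < lambda k /\ lambda k <= 1 / L.
    by move=> /par[-> _].
  exists lam; split=> //; split; first by move=> k /par[-> _].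
  split.
    move=> k k1; have [_ ->] := par k k1; have k1R : 1 <= k%:R :> R by rewrite ler1n.
    by split; [apply: divr_ge0; lra | rewrite ler_pdivrMr; lra].
  exact: (inertial_cvg_nesterov xs_opt yE (descent lamP) lam0 a2 par).
have xy0 : sqnorm (x k.+1 - y k.+1) @[k --> \oo] --> 0.
  apply: (cvg0_squeeze (c := 2) (w := fun k => D k.+1 + D k)) => [k k1|]; last first.
    by rewrite -[X in _ --> X](addr0 0); apply: cvgD => //; rewrite cvg_shiftS.
  split; first exact: sqnorm_ge0.
  have [a0 a1] := alphaP k k1.
  have -> : x k.+1 - y k.+1 = (x k.+1 - x k) - alpha k *: (x k - x k.-1).
    by rewrite yE // opprD addrA.
  apply: le_trans (sqnormB_le _ _) _; rewrite ler_pM2l // lerD2l sqnormZ.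
  by rewrite -[leRHS]mul1r; apply: ler_wpM2r; rewrite ?sqnorm_ge0 ?exprn_ile1.
(* The objective gap is known at [x k.+1] only, so the gradient is compared there first and carried
   to [y k.+1] by Lipschitz continuity. *)
have gy0 : sqnorm (grad f (y k.+1) - h) @[k --> \oo] --> 0.
  apply: (cvg0_squeeze (c := 2)
    (w := fun k => L ^+ 2 * sqnorm (x k.+1 - y k.+1) + 2 * L * V k.+1)) => [k k1|].
    split; first exact: sqnorm_ge0.
    have -> : grad f (y k.+1) - h =
        (grad f (y k.+1) - grad f (x k.+1)) - (h - grad f (x k.+1)).
      by rewrite opprB addrA subrK.
    apply: le_trans (sqnormB_le _ _) _; rewrite ler_pM2l //; apply: lerD.
      rewrite (sqnormBC (x k.+1)); exact: lipschitz2_sqnorm.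
    rewrite sqnormBC -grad_xs.
    exact: (sqnorm_grad_gap f_convex f_diff L_gt0 gradf_lip rho_gt0).
  rewrite -[X in _ --> X](addr0 0); apply: cvgD.
    by rewrite -[X in _ --> X](mulr0 (L ^+ 2)); apply: cvgMr.
  rewrite -[X in _ --> X](mulr0 (2 * L)); apply: cvgMr.
  by rewrite cvg_shiftS.
have coord (i : 'I_n) : \forall k \near \oo,
    (`|h 0 i| = rho -> sgn (y k.+1 0 i - lambda k * grad f (y k.+1) 0 i)
      = - (h 0 i / rho)) /\ (`|h 0 i| < rho -> x k.+1 0 i = 0).
  have x_soft k : (1 <= k)%N -> x k.+1 0 i =
      soft_threshold (lambda k * rho) (y k.+1 0 i - lambda k * grad f (y k.+1) 0 i).
    move=> k1; rewrite xE // prox_l1_soft_threshold ?mxE //.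
    by rewrite mulr_ge0 ?ltW // (lt_le_trans l00) // lamP.
  have dist0 e : 0 < e -> \forall k \near \oo, (1 <= k)%N /\
      `|grad f (y k.+1) 0 i - h 0 i| < e /\
      `|soft_threshold (lambda k * rho) (y k.+1 0 i - lambda k * grad f (y k.+1) 0 i)
        - y k.+1 0 i| < l0 * e.
    move=> e0; near=> k.
    have k1 : (1 <= k)%N by near: k; exact: nbhs_infty_ge.
    rewrite -x_soft //; do 2!split=> //.
      have : `|(grad f (y k.+1) - h) 0 i| < e by near: k; exact: sqnorm_cvg0_coord.
      by rewrite !mxE.
    have : `|(x k.+1 - y k.+1) 0 i| < l0 * e.
      by near: k; apply: sqnorm_cvg0_coord => //; exact: mulr_gt0.
    by rewrite !mxE.
  have [hlt|hge] := ltP `|h 0 i| rho.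
    have e0 : 0 < (rho - `|h 0 i|) / 2 by rewrite divr_gt0 // subr_gt0.
    apply: filterS (dist0 _ e0) => k [k1 [g1 s1]]; split=> [hr|_].
      by rewrite hr ltxx in hlt.
    by rewrite x_soft //; apply: soft_threshold_interior g1 s1 => //; exact: lamP.
  have e0 : 0 < rho / 2 by rewrite divr_gt0.
  apply: filterS (dist0 _ e0) => k [k1 [g1 s1]]; split=> // hr.
  by apply: sgn_boundary g1 s1 => //; exact: lamP.
have [N _ PN] := filter_forall _ coord.
(* [coord] at j concerns iterate j+1, and [y k.+3] vanishes through [x k.+2] and [x k.+1]; hence
   indices down to k are used, and the shift is 3. *)
exists N.+3 => // -[|[|[|k]]] //; rewrite /= !ltnS => Nk.
have Nk1 : (N <= k.+1)%N by exact: leqW.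
split=> i hi; first by have [-> //] := PN k.+2 (leqW Nk1) i.
have x1 := (PN k.+2 (leqW Nk1) i).2 hi.
split=> //; rewrite yE // !mxE (PN k.+1 Nk1 i).2 // (PN k Nk i).2 //.
by rewrite subrr mulr0 addr0.
Unshelve. all: by end_near.
Qed.
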